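(* Let $(M,\vec\xi,\eta,g,D)$ be a sub-Riemannian manifold of contact type whose sub-Riemannian structure has even rank. Then the canonical connection $\nabla^N$ (the $N$-connection with $N=2\psi$) is not a metric connection, i.e. $\nabla^N g\neq 0$.
   Context: A sub-Riemannian manifold of contact type $(M,\vec\xi,\eta,g,D)$ is a smooth manifold $M$ of odd dimension $n=2m+1$ with a Riemannian metric $g$, a unit vector field $\vec\xi$ and a 1-form $\eta$ with $\eta(X)=g(X,\vec\xi)$; $D=\ker\eta$, and $D^\perp=\mathrm{Span}(\vec\xi)$, so $TM=D\oplus D^\perp$. The exterior derivative convention is $2d\eta(X,Y)=X\eta(Y)-Y\eta(X)-\eta([X,Y])$, and $\omega=d\eta$. The rank of the sub-Riemannian structure is $2p$ (even) if $(d\eta)^p\neq0$ and $\eta\wedge(d\eta)^p=0$; it is $2p+1$ (odd) if $\eta\wedge(d\eta)^p\ne0$ and $(d\eta)^{p+1}=0$. The endomorphism $\psi:TM\to TM$ is transversal: $\psi\vec\xi=0$, $\psi(D)\subset D$ and $g(\psi X,Y)=\omega(X,Y)$ for $X,Y\in D$. The endomorphism $C:TM\to TM$ is transversal: $C\vec\xi=0$, $C(D)\subset D$ and $g(CX,Y)=\frac12(L_{\vec\xi}\,g)(X,Y)$ for $X,Y\in D$. Let $\widetilde\nabla$ be the Levi-Civita connection of $g$. For an endomorphism $N$ of $TM$ with $N\vec\xi=0$, $N(D)\subset D$, the $N$-connection is $$\nabla^N_XY=\widetilde\nabla_XY+(\widetilde\nabla_X\eta)(Y)\,\vec\xi-\eta(Y)\widetilde\nabla_X\vec\xi-\eta(X)(\widetilde\nabla_{\vec\xi}\,\eta)(Y)\,\vec\xi-\eta(X)(C+\psi-N)Y.$$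 For $N=2\psi$ it is called the canonical connection. *)

(* Defs.v *)
From HB Require Import structures.
From mathcomp Require Import all_boot all_order all_algebra all_fingroup.
From mathcomp Require Import all_classical all_reals all_analysis.
From mathcomp Require Import ring.

Set Implicit Arguments.
Unset Strict Implicit.
Unset Printing Implicit Defensive.

Import Order.TTheory GRing.Theory Num.Theory.
Import numFieldNormedType.Exports.

Local Open Scope classical_set_scope.
Local Open Scope ring_scope.

(* Meant for an open set [U]: [f] is of class C^k on [U]. *)
Fixpoint class_C (R : realType) (n k : nat) (U : set 'rV[R]_n)
    (f : 'rV[R]_n -> R) : Prop :=
  {in U, continuous f} /\
  (if k is k'.+1 then
     forall i : 'I_n, (forall x, U x -> derivable f x (delta_mx 0 i)) /\
                      class_C k' U (fun x => 'D_(delta_mx 0 i) f x)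
   else True).

Definition smooth_on (R : realType) (n : nat) (U : set 'rV[R]_n)
  (f : 'rV[R]_n -> R) : Prop := forall k, class_C k U f.

(* [chart_inv] is only meaningful on [chart_img]. *)
Record chart (R : realType) (T : topologicalType) (n : nat) := Chart {
  chart_dom : set T;
  chart_map : T -> 'rV[R]_n;
  chart_inv : 'rV[R]_n -> T;
  chart_dom_open : open chart_dom;
  chart_img_open : open (chart_map @` chart_dom);
  chart_mapK : {in chart_dom, cancel chart_map chart_inv};
  chart_map_continuous : {in chart_dom, continuous chart_map};
  chart_inv_continuous :
    {in chart_map @` chart_dom, continuous chart_inv} }.

Definition chart_img (R : realType) (T : topologicalType) (n : nat)
  (c : chart R T n) : set 'rV[R]_n := chart_map c @` chart_dom c.

(* The atlas need not be maximal: smoothness of functions is the same for an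
   atlas and for the maximal atlas that contains it. *)
Record smooth_manifold (R : realType) (n : nat) := SmoothManifold {
  manifold_carrier :> topologicalType;
  manifold_hausdorff : hausdorff_space manifold_carrier;
  manifold_second_countable : @second_countable manifold_carrier;
  manifold_atlas : set (chart R manifold_carrier n);
  manifold_cover : forall x, exists2 c, manifold_atlas c & chart_dom c x;
  manifold_compat : forall c d, manifold_atlas c -> manifold_atlas d ->
    forall j : 'I_n,
      smooth_on (chart_map c @` (chart_dom c `&` chart_dom d))
                (fun u => chart_map d (chart_inv c u) 0 j) }.

Section SmoothOn.
Variables (R : realType) (n : nat) (U : set 'rV[R]_n).
Hypothesis Uopen : open U.
Implicit Types f g : 'rV[R]_n -> R.

Lemma class_C_ext k f g :
  (forall x, U x -> f x = g x) -> class_C k U f -> class_C k U g.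
Proof.
have near_U (h1 h2 : 'rV[R]_n -> R) x : (forall x, U x -> h1 x = h2 x) ->
    U x -> {near x, h1 =1 h2}.
  move=> h12 Ux; have := open_nbhs_nbhs (conj Uopen Ux).
  by apply: filterS => y /h12.
elim: k f g => [|k IH] f g fg /= [fc fd]; (split; first last).
- by [].
- move=> x; rewrite inE => Ux; have /near_eq_cvg fgx := near_U _ _ _ fg Ux.
  rewrite /prop_for /continuous_at -(fg x Ux).
  by apply: cvg_trans (fgx) _; apply: fc; rewrite inE.
- move=> i; have [fdi fCi] := fd i; split=> [x Ux|].
    by apply: near_eq_derivable (fdi x Ux); apply: near_U.
  apply: IH fCi => x Ux; apply: near_eq_derive; exact: near_U.
- move=> x; rewrite inE => Ux; have /near_eq_cvg fgx := near_U _ _ _ fg Ux.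
  rewrite /prop_for /continuous_at -(fg x Ux).
  by apply: cvg_trans (fgx) _; apply: fc; rewrite inE.
Qed.

Lemma class_CW k f : class_C k.+1 U f -> class_C k U f.
Proof.
elim: k f => [|k IH] f; first by case.
by move=> [fc fd]; split=> // i; have [fdi /IH] := fd i.
Qed.

Lemma class_C_cst k (a : R) : class_C k U (cst a).
Proof.
elim: k a => [|k IH] a /=; (split; first by move=> x _; exact: cst_continuous) => //.
move=> i; split=> [x _|]; first exact: derivable_cst.
by apply: class_C_ext (IH 0) => x Ux; rewrite derive_cst.
Qed.

Lemma class_CD k f g : class_C k U f -> class_C k U g -> class_C k U (f + g).
Proof.
elim: k f g => [|k IH] f g [fc fd] [gc gd];
  (split; first by move=> x Ux; exact: cvgD (fc x Ux) (gc x Ux)) => //.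
move=> i; have [fdi fCi] := fd i; have [gdi gCi] := gd i; split=> [x Ux|].
  by apply: derivableD; [exact: fdi|exact: gdi].
apply: class_C_ext (IH _ _ fCi gCi) => x Ux.
by rewrite deriveD; [|exact: fdi|exact: gdi].
Qed.

Lemma class_CM k f g : class_C k U f -> class_C k U g -> class_C k U (f * g).
Proof.
elim: k f g => [|k IH] f g fC gC; have [fc fd] := fC; have [gc gd] := gC;
  (split; first by move=> x Ux; exact: cvgM (fc x Ux) (gc x Ux)) => //.
move=> i; have [fdi fCi] := fd i; have [gdi gCi] := gd i; split=> [x Ux|].
  by apply: derivableM; [exact: fdi|exact: gdi].
apply: class_C_ext (class_CD (IH _ _ (class_CW fC) gCi)
                             (IH _ _ (class_CW gC) fCi)) => x Ux.
by rewrite deriveM; [|exact: fdi|exact: gdi].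
Qed.

End SmoothOn.

Section SmoothFunctions.
Variables (R : realType) (n : nat) (M : smooth_manifold R n).

Definition is_smooth (f : M -> R) : Prop :=
  forall c, manifold_atlas c -> smooth_on (chart_img c) (f \o chart_inv c).

Definition smooth : {pred (M -> R)} := fun f => `[< is_smooth f >].

Lemma smooth_cst (a : R) : cst a \in smooth.
Proof. apply/asboolP => c _ k; apply: class_C_cst; exact: chart_img_open. Qed.

Lemma smoothD : {in smooth &, forall f g, f + g \in smooth}.
Proof.
move=> f g /asboolP fs /asboolP gs; apply/asboolP => c ac k.
exact (class_CD (@chart_img_open _ _ _ c) (fs c ac k) (gs c ac k)).
Qed.

Lemma smoothM : {in smooth &, forall f g, f * g \in smooth}.
Proof.
move=> f g /asboolP fs /asboolP gs; apply/asboolP => c ac k.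
exact (class_CM (@chart_img_open _ _ _ c) (fs c ac k) (gs c ac k)).
Qed.

Lemma smoothZ (a : R) f : f \in smooth -> a *: f \in smooth.
Proof. exact: (smoothM (smooth_cst a)). Qed.

Lemma smooth_subring_closed : subring_closed smooth.
Proof.
split; [exact: smooth_cst | | exact: smoothM].
move=> f g fs gs; rewrite -scaleN1r; apply: smoothD => //; exact: smoothZ.
Qed.

HB.instance Definition _ :=
  GRing.isSubringClosed.Build (M -> R) smooth smooth_subring_closed.

Lemma smooth_scaler_closed : GRing.scaler_closed smooth.
Proof. by move=> a f; exact: smoothZ. Qed.

HB.instance Definition _ :=
  GRing.isScaleClosed.Build R (M -> R) smooth smooth_scaler_closed.

Record smooth_fun := SmoothFun {
  smooth_val :> M -> R;
  _ : smooth_val \in smooth }.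

HB.instance Definition _ := [isSub for smooth_val].
HB.instance Definition _ := [Choice of smooth_fun by <:].
HB.instance Definition _ := GRing.SubChoice_isSubComPzRing.Build (M -> R)
  smooth smooth_fun smooth_subring_closed.
HB.instance Definition _ := [SubZmodule_isSubLmodule of smooth_fun by <:].

End SmoothFunctions.

Notation "'C^oo(' M )" := (smooth_fun M) (format "'C^oo(' M )") : type_scope.

Section VectorFields.
Variables (R : realType) (n : nat) (M : smooth_manifold R n).

Definition is_derivation (X : C^oo(M) -> C^oo(M)) : Prop :=
  (forall (a : R) (f h : C^oo(M)), X (a *: f + h) = a *: X f + X h) /\
  (forall f h : C^oo(M), X (f * h) = X f * h + f * X h).

(* The codomain [C^oo(M)^o] makes the functions [C^oo(M) -> C^oo(M)^o] a
   module over [C^oo(M)]. *)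
Definition derivation : {pred (C^oo(M) -> C^oo(M)^o)} :=
  fun X => `[< is_derivation X >].

Lemma smooth_scalerAl (a : R) (f h : C^oo(M)) : a *: (f * h) = a *: f * h.
Proof. by apply/val_inj/funext => x; exact: (mulrA a (f x) (h x)). Qed.

Lemma smooth_scalerAr (a : R) (f h : C^oo(M)) : a *: (f * h) = f * (a *: h).
Proof. by rewrite mulrC smooth_scalerAl mulrC. Qed.

Lemma derivation_submod_closed : submod_closed derivation.
Proof.
split.
  apply/asboolP; split=> [a f h|f h].
    by change (0 = a *: 0 + 0 :> C^oo(M)); rewrite scaler0 addr0.
  by change (0 = 0 * h + f * 0 :> C^oo(M)); rewrite mul0r mulr0 addr0.
move=> a X Y /asboolP[Xl Xm] /asboolP[Yl Ym]; apply/asboolP.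
have E f : (a *: X + Y) f = a * (X f : C^oo(M)) + Y f :> C^oo(M) by [].
split=> [b f h|f h]; rewrite !E.
  by rewrite Xl Yl mulrDr -smooth_scalerAr scalerDr addrACA.
by rewrite Xm Ym mulrDr mulrDl mulrDr !mulrA [f * a]mulrC addrACA.
Qed.

HB.instance Definition _ := GRing.isSubmodClosed.Build C^oo(M)
  (C^oo(M) -> C^oo(M)^o) derivation derivation_submod_closed.

(* Smooth vector fields, as the derivations of the algebra of smooth
   functions. *)
Record vector_field := VectorField {
  vector_field_val : C^oo(M) -> C^oo(M)^o;
  _ : vector_field_val \in derivation }.

HB.instance Definition _ := [isSub for vector_field_val].
HB.instance Definition _ := [Choice of vector_field by <:].
HB.instance Definition _ := [SubChoice_isSubZmodule of vector_field by <:].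
HB.instance Definition _ := [SubZmodule_isSubLmodule of vector_field by <:].

Definition vector_field_apply (X : vector_field) : C^oo(M) -> C^oo(M) :=
  vector_field_val X.
Coercion vector_field_apply : vector_field >-> Funclass.

Lemma vector_field_derivation (X : vector_field) : is_derivation X.
Proof. by case: X => X XP; exact/asboolP. Qed.

Lemma lie_bracket_subproof (X Y : vector_field) :
  (fun f => X (Y f) - Y (X f)) \in derivation.
Proof.
have [[Xl Xm] [Yl Ym]] :=
  (vector_field_derivation X, vector_field_derivation Y).
have XD f h : X (f + h) = X f + X h.
  by have := Xl 1 f h; rewrite !scale1r.
have YD f h : Y (f + h) = Y f + Y h.
  by have := Yl 1 f h; rewrite !scale1r.
apply/asboolP; split=> [a f h|f h].
  by rewrite Yl !Xl Yl opprD addrACA scalerBr.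
rewrite Xm Ym XD YD !Xm !Ym; ring.
Qed.

Definition lie_bracket (X Y : vector_field) : vector_field :=
  VectorField (lie_bracket_subproof X Y).

End VectorFields.

(* A [k]-form is encoded by its values on [k]-tuples of vector fields; the
   forms considered below are products of alternating C^oo(M)-multilinear
   maps. *)
Definition diff_form (R : realType) (n : nat) (M : smooth_manifold R n) (k : nat)
  : Type := ('I_k -> vector_field M) -> C^oo(M).

Section DifferentialForms.
Variables (R : realType) (n : nat) (M : smooth_manifold R n).

(* The factor 1/2 is the convention
   2 d eta (X, Y) = X eta(Y) - Y eta(X) - eta([X, Y]). *)
Definition ext_deriv (eta : {scalar vector_field M}) (X Y : vector_field M)
  : C^oo(M) :=
  2^-1 *: (X (eta Y) - Y (eta X) - eta (lie_bracket X Y)).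

Definition form1 (eta : vector_field M -> C^oo(M)) : diff_form M 1 :=
  fun X => eta (X ord0).

Definition form2 (omega : vector_field M -> vector_field M -> C^oo(M))
  : diff_form M 2 := fun X => omega (X ord0) (X ord_max).

(* The normalization 1/(k+l)! is the one that goes with the factor 1/2 in
   [ext_deriv]. *)
Definition wedge (k l : nat) (a : diff_form M k) (b : diff_form M l)
  : diff_form M (k + l) :=
  fun X => ((k + l)`!%:R^-1 : R) *:
    \sum_(s : 'S_(k + l)) (-1) ^+ s *
      (a (fun i => X (s (lshift l i))) * b (fun j => X (s (rshift k j)))).

Fixpoint wedge_pow (omega : diff_form M 2) (p : nat) : diff_form M (p * 2) :=
  match p with
  | 0 => fun=> 1
  | p'.+1 => wedge omega (@wedge_pow omega p')
  end.

Definition form_zero (k : nat) (a : diff_form M k) : Prop := forall X, a X = 0.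

End DifferentialForms.

Arguments wedge_pow {R n M} omega p X.

Section Riemannian.
Variables (R : realType) (n : nat) (M : smooth_manifold R n).

(* In the last axiom, [forall f, X f x = 0] says that the tangent vector of
   [X] at [x] is zero. *)
Record riemannian_metric := RiemannianMetric {
  rmetric_val :> vector_field M -> vector_field M -> C^oo(M);
  rmetric_sym : forall X Y, rmetric_val X Y = rmetric_val Y X;
  rmetric_linear : forall Y, scalar (rmetric_val ^~ Y);
  rmetric_ge0 : forall X (x : M), 0 <= rmetric_val X X x;
  rmetric_def : forall X (x : M),
    rmetric_val X X x = 0 -> forall f : C^oo(M), X f x = 0 }.

Record is_affine_connection
    (nabla : vector_field M -> vector_field M -> vector_field M) : Prop := {
  connection_linear : forall Y, linear (nabla ^~ Y);
  connection_add : forall X Y Z, nabla X (Y + Z) = nabla X Y + nabla X Z;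
  connection_leibniz : forall X (f : C^oo(M)) Y,
    nabla X (f *: Y) = X f *: Y + f *: nabla X Y }.

Definition cov_deriv_form
    (nabla : vector_field M -> vector_field M -> vector_field M)
    (eta : vector_field M -> C^oo(M)) (X Y : vector_field M) : C^oo(M) :=
  X (eta Y) - eta (nabla X Y).

Definition cov_deriv_metric
    (nabla : vector_field M -> vector_field M -> vector_field M)
    (g : vector_field M -> vector_field M -> C^oo(M))
    (X Y Z : vector_field M) : C^oo(M) :=
  X (g Y Z) - g (nabla X Y) Z - g Y (nabla X Z).

Definition is_metric_connection (g : riemannian_metric)
    (nabla : vector_field M -> vector_field M -> vector_field M) : Prop :=
  forall X Y Z, cov_deriv_metric nabla g X Y Z = 0.

Record is_levi_civita (g : riemannian_metric)
    (nabla : vector_field M -> vector_field M -> vector_field M) : Prop := {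
  levi_civita_affine : is_affine_connection nabla;
  levi_civita_torsion_free : forall X Y,
    nabla X Y - nabla Y X = lie_bracket X Y;
  levi_civita_metric : is_metric_connection g nabla }.

Definition lie_deriv_metric (xi : vector_field M) (g : riemannian_metric)
    (X Y : vector_field M) : C^oo(M) :=
  xi (g X Y) - g (lie_bracket xi X) Y - g X (lie_bracket xi Y).

End Riemannian.

Record contact_type_structure (R : realType) (n : nat)
    (M : smooth_manifold R n) := ContactTypeStructure {
  sr_metric : riemannian_metric M;
  sr_xi : vector_field M;
  sr_eta : {scalar vector_field M};
  sr_xi_unit : sr_metric sr_xi sr_xi = 1;
  sr_etaE : forall X, sr_eta X = sr_metric X sr_xi }.

Section ContactType.
Variables (R : realType) (n : nat) (M : smooth_manifold R n).
Variable S : contact_type_structure M.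

Local Notation g := (sr_metric S).
Local Notation xi := (sr_xi S).
Local Notation eta := (sr_eta S).

(* Sections of the distribution D = ker eta. *)
Definition sr_D : set (vector_field M) := [set X | eta X = 0].

Definition sr_omega : vector_field M -> vector_field M -> C^oo(M) :=
  ext_deriv eta.

Definition has_rank (r : nat) : Prop :=
  let eta1 := form1 eta in let deta := form2 sr_omega in
  if odd r then
    ~ form_zero (wedge eta1 (wedge_pow deta r./2)) /\
    form_zero (wedge_pow deta r./2.+1)
  else
    ~ form_zero (wedge_pow deta r./2) /\
    form_zero (wedge eta1 (wedge_pow deta r./2)).

Definition transversal_endo (N : vector_field M -> vector_field M) : Prop :=
  N xi = 0 /\ (forall X, sr_D X -> sr_D (N X)).

Definition is_psi (psi : {linear vector_field M -> vector_field M}) : Prop :=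
  transversal_endo psi /\
  (forall X Y, sr_D X -> sr_D Y -> g (psi X) Y = sr_omega X Y).

Definition is_C (C : {linear vector_field M -> vector_field M}) : Prop :=
  transversal_endo C /\
  (forall X Y, sr_D X -> sr_D Y ->
     g (C X) Y = (2^-1 : R) *: lie_deriv_metric xi g X Y).

(* [nabla] is meant to be the Levi-Civita connection of the metric. *)
Definition N_connection
    (nabla : vector_field M -> vector_field M -> vector_field M)
    (C psi N : {linear vector_field M -> vector_field M})
    (X Y : vector_field M) : vector_field M :=
  nabla X Y + cov_deriv_form nabla eta X Y *: xi - eta Y *: nabla X xi
  - (eta X * cov_deriv_form nabla eta xi Y) *: xi
  - eta X *: (C Y + psi Y - N Y).

Definition canonical_connection
    (nabla : vector_field M -> vector_field M -> vector_field M)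
    (C psi : {linear vector_field M -> vector_field M}) :=
  N_connection nabla C psi (2 \*: psi).

End ContactType.

(* Main.v *)
Require Import Defs.
From mathcomp Require Import all_boot all_order all_algebra.
From mathcomp Require Import all_classical all_reals all_analysis.
From mathcomp Require Import all_fingroup ring.

(** Write N for the canonical connection and evaluate the covariant derivative
    of g by N on the triples (xi, Y, xi). Since N_xi xi = 0 and
    eta(N_xi Y) = eta(nabla_xi Y), where nabla is the Levi-Civita connection,
    that component of the derivative of g is (nabla_xi eta)(Y)
    ([cov_deriv_metric_canonical]), which is 2 d eta(xi, Y)
    ([sr_omega_xi_nabla]). So a metric canonical connection forces the interior
    product of d eta with xi to vanish ([metric_omega_annihilated]), and hence
    also that of (d eta)^p ([wedge_pow_annihilated]).

    Even rank 2p means eta /\ (d eta)^p = 0. Inserting xi into this product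
    leaves a nonzero multiple of eta(xi) (d eta)^p = (d eta)^p, because the second
    factor is killed by xi; so (d eta)^p = 0 ([wedge_form1_eq0]), which
    contradicts the other half of even rank. *)

Local Open Scope ring_scope.

Import GRing.Theory Num.Theory.

Section Forms.
Context {R : realType} {n : nat} {M : smooth_manifold R n}.

(** For an alternating form: its interior product with [v] is zero. It is asked
    in every slot, so that it passes through wedge products without any
    symmetry of the factors. *)
Definition annihilated_by (v : vector_field M) {k} (a : diff_form M k) : Prop :=
  forall X i, X i = v -> a X = 0.

Definition alternating {k} (a : diff_form M k) : Prop :=
  forall X (t : 'S_k), a (fun i => X (t i)) = (-1) ^+ t * a X.

(** In each summand of the wedge product, [v] is an argument of one of the two
    factors. *)
Lemma wedge_annihilated v k l (a : diff_form M k) (b : diff_form M l) :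
  annihilated_by v a -> annihilated_by v b -> annihilated_by v (wedge a b).
Proof.
move=> av bv X i Xi; rewrite /wedge big1 ?scaler0 // => s _.
have [j sj] : exists j, s j = i by exists ((s^-1)%g i); rewrite permKV.
case: (split_ordP j) sj => {}j -> sj.
  by rewrite (av _ j) ?sj // mul0r mulr0.
by rewrite (bv _ j) ?sj // !mulr0.
Qed.

(** The factors can be arbitrary, because [wedge] antisymmetrizes over the whole
    symmetric group. *)
Lemma wedge_alternating k l (a : diff_form M k) (b : diff_form M l) :
  alternating (wedge a b).
Proof.
move=> X t; rewrite /wedge -smooth_scalerAr; congr (_ *: _).
rewrite mulr_sumr [RHS](reindex_inj (mulIg t)); apply: eq_bigr => s _ /=.
rewrite odd_permM addbC signr_addb -mulrA signrMK.
by congr (_ * (a _ * b _)); apply/funext => i; rewrite permM.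
Qed.

Lemma wedge_pow_annihilated v (w : diff_form M 2) p :
  annihilated_by v w -> annihilated_by v (wedge_pow w p).
Proof.
move=> wv; elim: p => [|p IH]; first by move=> X [].
exact: wedge_annihilated.
Qed.

(** The power 0 is not a wedge product, but a form of degree 0 has only the
    trivial permutation. *)
Lemma wedge_pow_alternating (w : diff_form M 2) p : alternating (wedge_pow w p).
Proof.
case: p => [|p]; last exact: wedge_alternating.
move=> X t; have -> : t = 1%g by apply/permP => -[].
by rewrite odd_perm1 mul1r.
Qed.

Lemma perm_fix0_lift l (s : 'S_l.+1) :
  s ord0 = ord0 -> exists t : 'S_l, s = lift_perm ord0 ord0 t.
Proof.
move=> s0.
have liftex k : exists j, s (lift ord0 k) = lift ord0 j.
  case: (unliftP ord0 (s (lift ord0 k))) => [j ->|]; first by exists j.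
  by rewrite -{2}s0 => /perm_inj.
have [f fE] := choice liftex.
have f_inj : injective f.
  move=> j k fjk; apply/(lift_inj (h := ord0))/(perm_inj (s := s)).
  by rewrite !fE fjk.
exists (perm f_inj); apply/permP => k.
case: (unliftP ord0 k) => [j|] ->; last by rewrite lift_perm_id.
by rewrite lift_perm_lift permE fE.
Qed.

(** Evaluate the product on [v] followed by the arguments of [b]. A permutation
    that moves [v] away from the argument of [eta] hands it to [b] and
    contributes 0; one that fixes the index 0 contributes [b X], as its sign is
    cancelled by the alternation of [b]. There is at least one of the latter
    kind, the identity, so the sum is a nonzero multiple of [b X]. *)
Lemma wedge_form1_eq0 (eta : vector_field M -> C^oo(M)) v l (b : diff_form M l) :
  eta v = 1 -> annihilated_by v b -> alternating b ->
  form_zero (wedge (form1 eta) b) -> form_zero b.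
Proof.
move=> etav bv balt etab0 X.
pose Y := fun i : 'I_(1 + l) => if unlift ord0 i is Some j then X j else v.
have Y0 : Y (ord0 : 'I_l.+1) = v by rewrite /Y unlift_none.
pose term (s : 'S_(1 + l)) : C^oo(M) := (-1) ^+ s *
  (form1 eta (fun i => Y (s (lshift l i))) * b (fun j => Y (s (rshift 1 j)))).
have termN (s : 'S_(1 + l)) : s ord0 != ord0 -> term s = 0.
  move=> s0; have [j sj] : exists j, s j = ord0.
    by exists ((s^-1)%g ord0); rewrite permKV.
  case: (split_ordP j) sj => {}j -> sj.
    by move: sj s0; rewrite (ord1 j : j = ord0) lshift0 => ->; rewrite eqxx.
  by rewrite /term (bv _ j) ?mulr0 // sj Y0.
have term0 (s : 'S_(1 + l)) : s ord0 == ord0 -> term s = b X.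
  move=> /eqP/perm_fix0_lift[t ->].
  rewrite /term /form1 lshift0 lift_perm_id Y0 etav mul1r odd_lift_perm /=.
  have -> : (fun j => Y (lift_perm ord0 ord0 t (rshift 1 j))) = fun j => X (t j).
    by apply/funext => j; rewrite rshift1 lift_perm_lift /Y liftK.
  by rewrite balt signrMK.
have := etab0 Y; rewrite /wedge -[X in _ *: X]/(\sum_s term s).
rewrite (bigID (fun s : 'S_(1 + l) => s ord0 == ord0)) /= (eq_bigr _ term0).
rewrite (eq_bigr (fun=> 0) termN) big1_eq addr0 sumr_const -scalerMnr scalerMnl.
set c := _ *+ _; have c0 : c != 0.
  rewrite mulrn_eq0 invr_eq0 pnatr_eq0 negb_or -!lt0n fact_gt0 andbT.
  by apply/card_gt0P; exists 1%g; rewrite unfold_in perm1.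
by move=> /(congr1 (fun f => c^-1 *: f)); rewrite scalerA mulVf // scale1r scaler0.
Qed.

End Forms.

Section VectorFields.
Context {R : realType} {n : nat} {M : smooth_manifold R n}.

Lemma smooth_double_eq0 (f : C^oo(M)) : f + f = 0 -> f = 0.
Proof.
rewrite -mulr2n -scaler_nat => /(congr1 ( *:%R (2^-1 : R))).
by rewrite scalerA mulVf ?pnatr_eq0 // scale1r scaler0.
Qed.

Lemma vector_field1 (X : vector_field M) : X 1 = 0.
Proof.
have [_ XM] := vector_field_derivation X.
by apply: (addrI (X 1)); rewrite addr0 -[in RHS](mulr1 1) XM mulr1 mul1r.
Qed.

End VectorFields.

Section Contact.
Context {R : realType} {n : nat} {M : smooth_manifold R n}.
Context {S : contact_type_structure M}.
Local Notation g := (sr_metric S).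
Local Notation xi := (sr_xi S).
Local Notation eta := (sr_eta S).

Lemma eta_xi : eta xi = 1.
Proof. by rewrite sr_etaE sr_xi_unit. Qed.

(** [N] takes values in D on all vector fields, not only on those of D, because
    it is linear over smooth functions and kills [xi]. *)
Lemma eta_transversal (N : {linear vector_field M -> vector_field M}) Y :
  transversal_endo S N -> eta (N Y) = 0.
Proof.
move=> [Nxi ND].
have YD : sr_D S (Y - eta Y *: xi).
  by rewrite /sr_D /= linearB linearZ /= eta_xi mulr1 subrr.
by have := ND _ YD; rewrite /sr_D /= linearB linearZ /= Nxi scaler0 subr0.
Qed.

Lemma sr_omegaC X Y : sr_omega S X Y = - sr_omega S Y X.
Proof.
rewrite /sr_omega /ext_deriv -scalerN; congr (_ *: _).
have -> : lie_bracket X Y = - lie_bracket Y X.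
  by apply/val_inj/funext => f /=; rewrite opprB.
by rewrite raddfN /=; ring.
Qed.

Context {nabla : vector_field M -> vector_field M -> vector_field M}.
Hypothesis nablaLC : is_levi_civita g nabla.

(** Differentiate g(xi, xi) = 1. *)
Lemma eta_nabla_xi X : eta (nabla X xi) = 0.
Proof.
have /eqP := levi_civita_metric nablaLC X xi xi.
rewrite /cov_deriv_metric sr_xi_unit vector_field1 sub0r -opprD oppr_eq0.
by rewrite [g xi _]rmetric_sym -sr_etaE => /eqP/smooth_double_eq0.
Qed.

(** As nabla is torsion-free, eta([xi, Y]) = eta(nabla_xi Y) - eta(nabla_Y xi),
    and the last term vanishes. *)
Lemma sr_omega_xi_nabla Y :
  sr_omega S xi Y = (2^-1 : R) *: cov_deriv_form nabla eta xi Y.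
Proof.
rewrite /sr_omega /ext_deriv eta_xi vector_field1 subr0.
congr (_ *: _); rewrite -(levi_civita_torsion_free nablaLC) linearB /=.
by rewrite (eta_nabla_xi Y) subr0.
Qed.

Context {psi C : {linear vector_field M -> vector_field M}}.
Hypotheses (psiT : transversal_endo S psi) (CT : transversal_endo S C).
Local Notation nablaN := (canonical_connection S nabla C psi).

(** The term - eta(xi) nabla_xi xi of the connection cancels nabla_xi xi. *)
Lemma canonical_xi_xi : nablaN xi xi = 0.
Proof.
rewrite /canonical_connection /N_connection /cov_deriv_form /=.
rewrite eta_xi vector_field1 eta_nabla_xi.
by rewrite CT.1 psiT.1 !(scale1r, subr0, scale0r, scaler0, mulr0, addr0, subrr).
Qed.

(** For X = xi the two terms along xi cancel each other, and nabla_xi xi, C Y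
    and psi Y lie in ker eta. *)
Lemma eta_canonical_xi Y : eta (nablaN xi Y) = eta (nabla xi Y).
Proof.
rewrite /canonical_connection /N_connection !(linearB, linearD, linearZ) /=.
rewrite !eta_transversal // eta_xi eta_nabla_xi.
ring.
Qed.

(** Both sides are xi(eta Y) - eta(nabla_xi Y). *)
Lemma cov_deriv_metric_canonical Y :
  cov_deriv_metric nablaN g xi Y xi = cov_deriv_form nabla eta xi Y.
Proof.
have gY0 : g Y 0 = 0.
  have /= := rmetric_linear g Y (-1 : C^oo(M)) 0 0.
  by rewrite scaler0 addr0 mulN1r addNr rmetric_sym.
by rewrite /cov_deriv_metric canonical_xi_xi gY0 subr0 -!sr_etaE
           eta_canonical_xi.
Qed.

Lemma metric_omega_annihilated :
  is_metric_connection g nablaN -> annihilated_by xi (form2 (sr_omega S)).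
Proof.
move=> met.
have w0 Y : sr_omega S xi Y = 0.
  by rewrite sr_omega_xi_nabla -cov_deriv_metric_canonical met scaler0.
move=> X i; rewrite /form2; have [->|->] : i = ord0 \/ i = ord_max.
  by case: i => -[|[|//]] ?; [left|right]; exact: val_inj.
- by move=> ->.
- by move=> ->; rewrite sr_omegaC w0 oppr0.
Qed.

End Contact.

Theorem mainTheorem2 (R : realType) (m : nat)
    (M : smooth_manifold R (2 * m).+1)
    (S : contact_type_structure M)
    (psi C : {linear vector_field M -> vector_field M})
    (nabla : vector_field M -> vector_field M -> vector_field M)
    (hpsi : is_psi S psi) (hC : is_C S C)
    (hnabla : is_levi_civita (sr_metric S) nabla)
    (r : nat) (r_even : ~~ odd r) (hrank : has_rank S r) :
  ~ is_metric_connection (sr_metric S) (canonical_connection S nabla C psi).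
Proof.
move=> met; have xi_deta := metric_omega_annihilated hnabla hpsi.1 hC.1 met.
move: hrank; rewrite /has_rank (negbTE r_even) => -[deta_neq0 eta_deta0].
apply/deta_neq0/(wedge_form1_eq0 _ _ _ _ eta_xi _ _ eta_deta0).
  exact: wedge_pow_annihilated.
exact: wedge_pow_alternating.
Qed.
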